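(* Let $k \ge 1$ be an integer and let $\mathbf{A} \in \{0,1\}^{d \times n}$ be any binary matrix. Then there exist $\mathbf{P}_A \in \{0,1\}^{d \times k}$, whose $k$ columns are chosen from the columns of $\mathbf{A}$, and $\mathbf{Q} \in \{0,1\}^{k \times n}$ such that \[ \|\mathbf{A} - \mathbf{P}_A \mathbf{Q}\|_F^2 \le \left(\frac{k}{2} + 1 + \frac{k}{2(2^k-1)}\right) \mathrm{OPT}_k, \] where $\mathrm{OPT}_k := \min_{\mathbf{U} \in \{0,1\}^{d\times k},\, \mathbf{V} \in \{0,1\}^{k \times n}} \|\mathbf{A} - \mathbf{U}\mathbf{V}\|_F^2$. All matrix products are computed over $\mathrm{GF}(2)$.
   Context: All matrices are binary and all matrix operations (products, sums) are over the field $\mathrm{GF}(2)$. For a binary matrix $\mathbf{M}$, $\|\mathbf{M}\|_F^2$ is the number of entries of $\mathbf{M}$ equal to $1$. *)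

(* Defs.v *)
From mathcomp Require Import all_boot all_order all_algebra.

Set Implicit Arguments.
Unset Strict Implicit.
Unset Printing Implicit Defensive.

Import Order.TTheory GRing.Theory Num.Theory.
Local Open Scope ring_scope.

(* Binary matrices are matrices over the field 'F_2, so that *m and - are     *)
(* the GF(2) operations, while norms are genuine natural numbers.             *)

Definition sqnormF (m n : nat) (M : 'M['F_2]_(m, n)) : nat :=
  #|[set ij : 'I_m * 'I_n | M ij.1 ij.2 == 1]|.

Definition factor_err (d n k : nat) (A : 'M['F_2]_(d, n))
    (UV : 'M['F_2]_(d, k) * 'M['F_2]_(k, n)) : nat :=
  sqnormF (A - UV.1 *m UV.2).

(* The pair (0, 0) only witnesses that the set of pairs being minimized over  *)
(* is inhabited.                                                              *)
Definition OPT (d n : nat) (k : nat) (A : 'M['F_2]_(d, n)) : nat :=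
  factor_err A
    [arg min_(UV < ((0%R, 0%R) : 'M['F_2]_(d, k) * 'M['F_2]_(k, n)))
       factor_err A UV]%N.

Lemma OPT_attained (d n k : nat) (A : 'M['F_2]_(d, n)) :
  exists (U : 'M['F_2]_(d, k)) (V : 'M['F_2]_(k, n)),
    OPT k A = sqnormF (A - U *m V).
Proof. by rewrite /OPT; set UV := (X in factor_err A X); exists UV.1, UV.2. Qed.

Lemma OPT_le (d n k : nat) (A : 'M['F_2]_(d, n))
    (U : 'M['F_2]_(d, k)) (V : 'M['F_2]_(k, n)) :
  (OPT k A <= sqnormF (A - U *m V))%N.
Proof. by rewrite /OPT; case: arg_minnP => // i _; move=> /(_ (U, V) isT). Qed.

(* Main.v *)
(* Let A = U V + E with (U, V) optimal; one may assume that V has full row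
   rank r <= k. If the columns v_i (i in S) of V form a basis of F_2^r, then
   writing every column of V in that basis yields Q with
   A - A_S Q = E - E_S Q, of weight at most |E| + sum_(i in S) |e_i| N(H_i),
   where H_i is the hyperplane spanned by the v_j (j in S, j <> i) and N(H)
   counts the columns of V outside H.

   Draw S with probability proportional to the product of q_i := 1 / g_i over
   i in S, where g_i := |e_i| + delta, so that q_i g_i = 1. The expected sum is
   r L / Z, where L = sum_T q_T N(H_T)^2 over independent sequences T of r - 1
   columns and Z is the normalizing constant. The theorem follows from
     L <= gamma_r Z X,  gamma_r = 2^(r-1) / (2^r - 1),  X = sum_i q_i g_i^2,
   proved by induction on r from two bounds involving the same quantity a:
     L <= 2^(r-1) a              (Cauchy-Schwarz over the points outside H_T)
     L <= gamma_(r-1) (Z X - a)  (contract one column and apply induction).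
   Since 1 / gamma_r = 1 / gamma_(r-1) + 1 / 2^(r-1), they combine exactly. *)

Require Import Defs.
From mathcomp Require Import all_boot all_order all_algebra.
From mathcomp Require Import zify ring lra.

Set Implicit Arguments.
Unset Strict Implicit.
Unset Printing Implicit Defensive.

Import Order.TTheory GRing.Theory Num.Theory.
Local Open Scope ring_scope.

Lemma weighted_cauchy (R : realFieldType) (I : finType) (P : pred I)
    (q g : I -> R) : (forall i, 0 <= q i) ->
  (\sum_(i | P i) q i * g i) ^+ 2 / (\sum_(i | P i) q i)
    <= \sum_(i | P i) q i * g i ^+ 2.
Proof.
move=> q_ge0; set A := \sum_(i | P i) _ * _; set C := \sum_(i | P i) q i.
have [C0|C0] := eqVneq C 0.
  by rewrite C0 invr0 mulr0 sumr_ge0 // => i _; rewrite mulr_ge0 ?sqr_ge0.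
(* The inequality is nonnegativity of the weighted variance of [g] about its mean [A / C]. *)
have: 0 <= \sum_(i | P i) q i * (g i - A / C) ^+ 2.
  by rewrite sumr_ge0 // => i _; rewrite mulr_ge0 ?sqr_ge0.
have -> : \sum_(i | P i) q i * (g i - A / C) ^+ 2 =
    \sum_(i | P i) q i * g i ^+ 2 - 2 * (A / C) * A + (A / C) ^+ 2 * C.
  rewrite /A /C !mulr_sumr -sumrB -big_split /=.
  by apply: eq_bigr => i _; ring.
have -> : A ^+ 2 / C = 2 * (A / C) * A - (A / C) ^+ 2 * C by field.
by lra.
Qed.

(** * Subgroups of an elementary abelian 2-group *)

Section Subgroups.
Variable V : finZmodType.
Hypothesis addVV : forall x : V, x + x = 0.
Implicit Types (W H : {set V}) (x y u w : V).

Definition subgrp (W : {set V}) :=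
  0 \in W /\ forall x y, x \in W -> y \in W -> x + y \in W.

(** In characteristic 2, a subgroup [W] and its coset [u + W] together form the subgroup generated
    by [W] and [u]. *)
Definition ext (W : {set V}) (u : V) : {set V} :=
  [set x | (x \in W) || (x + u \in W)].

Lemma addKV (x u : V) : x + u + u = x.
Proof. by rewrite -addrA addVV addr0. Qed.

Lemma subgrpD W x y : subgrp W -> y \in W -> (x + y \in W) = (x \in W).
Proof.
move=> [_ WD] yW; apply/idP/idP => [xyW|xW]; last exact: WD.
by rewrite -[x](addKV _ y) WD.
Qed.

Lemma sub_ext W u : W \subset ext W u.
Proof. by apply/subsetP => x xW; rewrite inE xW. Qed.

Lemma subgrp_ext W u : subgrp W -> subgrp (ext W u).
Proof.
move=> Wg; split=> [|x y]; first by case: Wg => W0 _; rewrite inE W0.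
rewrite !inE => /orP[xW|xuW] yW.
  by rewrite [x + y]addrC (subgrpD _ Wg xW) addrAC (subgrpD _ Wg xW).
rewrite orbC -(subgrpD (x + y) Wg xuW).
have -> : x + y + (x + u) = y + u by rewrite addrACA addVV add0r.
  by rewrite addrAC [x + u + y]addrC (subgrpD _ Wg xuW).
Qed.

Lemma extC W u w : ext (ext W u) w = ext (ext W w) u.
Proof. by apply/setP => x; rewrite !inE (addrAC x w u) orbACA. Qed.

Lemma card_shift W x : #|[set y | x + y \in W]| = #|W|.
Proof.
rewrite -[RHS](card_imset _ (addrI x)); apply: eq_card => y; rewrite inE.
apply/idP/imsetP => [xyW|[z zW ->]]; last by rewrite addrA addVV add0r.
by exists (x + y); rewrite // addrA addVV add0r.
Qed.

Lemma card_ext W u : subgrp W -> u \notin W -> #|ext W u| = (2 * #|W|)%N.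
Proof.
move=> Wg uW; have -> : ext W u = W :|: [set y | u + y \in W].
  by apply/setP => x; rewrite !inE addrC.
rewrite cardsU card_shift mul2n -addnn; have -> : W :&: [set y | u + y \in W] = set0.
  apply/setP => x; rewrite !inE; apply/negbTE/negP => /andP[xW].
  by rewrite subgrpD // (negbTE uW).
by rewrite cards0 subn0.
Qed.

Lemma ext_swap W u w : subgrp W ->
  (u \notin W) && (w \notin ext W u) = (w \notin W) && (u \notin ext W w).
Proof. by move=> Wg; rewrite !inE !negb_or (addrC w u) andbCA. Qed.

(** * Sampling independent columns with product weights *)

Section Sampling.
Variables (R : realFieldType) (I : finType) (v : I -> V) (q g : I -> R).
Hypothesis q_gt0 : forall i, 0 < q i.

Let q_ge0 i : 0 <= q i := ltW (q_gt0 i).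

Fixpoint spanset (W : {set V}) (t : seq I) : {set V} :=
  if t is i :: t' then spanset (ext W (v i)) t' else W.

Fixpoint indep (W : {set V}) (t : seq I) : bool :=
  if t is i :: t' then (v i \notin W) && indep (ext W (v i)) t' else true.

(* Unnormalized expectation of [F] over ordered sequences of [j] columns that
   are independent modulo [W], a sequence weighing the product of its [q i]. *)
Fixpoint wsum (j : nat) (W : {set V}) (F : seq I -> R) : R :=
  if j is j'.+1 then
    \sum_(i | v i \notin W)
       q i * wsum j' (ext W (v i)) (fun t => F (i :: t))
  else F [::].

Lemma eq_wsum j W F G : (forall t, F t = G t) -> wsum j W F = wsum j W G.
Proof.
elim: j W F G => [|j IH] W F G FG //=.
by apply: eq_bigr => i _; congr (_ * _); apply: IH.
Qed.

Lemma wsum_le j W F G :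
    (forall t, size t = j -> indep W t -> F t <= G t) ->
  wsum j W F <= wsum j W G.
Proof.
elim: j W F G => [|j IH] W F G FG /=; first exact: FG.
apply: ler_sum => i iW; apply: ler_wpM2l => //; apply: IH => t tj ti.
by apply: FG => /=; rewrite ?tj ?iW.
Qed.

Lemma wsum_gt0_ex j W F : 0 < wsum j W F ->
  exists t, [/\ size t = j, indep W t & 0 < F t].
Proof.
elim: j W F => [|j IH] W F /= F0; first by exists [::].
have /existsP[i /andP[iW]] :
    [exists i, (v i \notin W)
       && (0 < q i * wsum j (ext W (v i)) (fun t => F (i :: t)))].
  apply: contraLR F0 => /existsPn no; rewrite -leNgt; apply: sumr_le0 => i iW.
  by have := no i; rewrite iW -leNgt.
rewrite pmulr_rgt0 // => /IH[t [tj ti Ft]].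
by exists (i :: t); rewrite /= tj iW.
Qed.

Lemma wsumD j W F G :
  wsum j W (fun t => F t + G t) = wsum j W F + wsum j W G.
Proof.
elim: j W F G => [|j IH] W F G //=; rewrite -big_split /=.
by apply: eq_bigr => i _; rewrite -mulrDr -IH.
Qed.

Lemma wsumZ j W a F : wsum j W (fun t => a * F t) = a * wsum j W F.
Proof.
elim: j W F => [|j IH] W F //=; rewrite mulr_sumr.
by apply: eq_bigr => i _; rewrite IH mulrCA.
Qed.

(** Neither independence modulo [W] nor the product weight depends on the order of the columns, so
    the column drawn last may as well be drawn first. *)
Lemma wsum_swap j W (F : I -> seq I -> R) : subgrp W ->
  wsum j W (fun t => \sum_(i | v i \notin spanset W t) q i * F i t) =
  \sum_(i | v i \notin W) q i * wsum j (ext W (v i)) (F i).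
Proof.
elim: j W F => [|j IH] W F Wg //=.
transitivity (\sum_(a | v a \notin W) \sum_(i | v i \notin ext W (v a))
    q a * (q i * wsum j (ext (ext W (v a)) (v i)) (fun t => F i (a :: t)))).
  apply: eq_bigr => a aW; rewrite -mulr_sumr; congr (_ * _).
  by rewrite (IH _ (fun i t => F i (a :: t))) //; apply: subgrp_ext.
rewrite (exchange_big_dep (fun i => v i \notin W)) /=; last first.
  by move=> a i aW; apply: contra; apply/subsetP/sub_ext.
apply: eq_bigr => i iW; rewrite mulr_sumr; apply: eq_big => [a|a _].
  by rewrite ext_swap // iW.
by rewrite mulrCA extC.
Qed.

Lemma subgrp_span W t : subgrp W -> subgrp (spanset W t).
Proof. by elim: t W => [|i t IH] W Wg //=; apply/IH/subgrp_ext. Qed.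

Lemma sub_span W t : W \subset spanset W t.
Proof.
elim: t W => [|i t IH] W //=; exact: subset_trans (sub_ext _ _) (IH _).
Qed.

Lemma card_span W t : subgrp W -> indep W t ->
  #|spanset W t| = (2 ^ size t * #|W|)%N.
Proof.
elim: t W => [|i t IH] W Wg /=; first by rewrite mul1n.
case/andP=> iW ti; rewrite IH ?card_ext //; last exact: subgrp_ext.
by rewrite mulnA -expnSr.
Qed.

(** * Second moment of the mass outside a random hyperplane, and the expected cost of a basis *)

Definition mass (H : {set V}) : R := \sum_(i | v i \notin H) q i * g i.
Definition energy (H : {set V}) : R := \sum_(i | v i \notin H) q i * g i ^+ 2.
Definition total (j : nat) (W : {set V}) : R := wsum j W (fun=> 1).

(* The same sums over one coset: in characteristic 2, [v i + x \in W] says that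
   [v i] and [x] are congruent modulo [W]. *)
Definition cmass (W : {set V}) (x : V) : R :=
  \sum_(i | v i + x \in W) q i * g i.
Definition cweight (W : {set V}) (x : V) : R := \sum_(i | v i + x \in W) q i.
Definition cenergy (W : {set V}) (x : V) : R := cmass W x ^+ 2 / cweight W x.

Lemma total_ge0 j W : 0 <= total j W.
Proof.
rewrite /total; elim: j W => [|j IH] W //=.
by apply: sumr_ge0 => i _; rewrite mulr_ge0.
Qed.

(** Enlarging [W] by [u] removes exactly the columns in [u + W] from the energy; by Cauchy-Schwarz
    their share is at least [cenergy W u]. *)
Lemma energy_ext W u : subgrp W -> u \notin W ->
  energy (ext W u) + cenergy W u <= energy W.
Proof.
move=> Wg uW; rewrite [leRHS](bigID (fun i => v i + u \notin W)) /=.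
apply: lerD.
  by rewrite le_eqVlt; apply/orP/or_introl/eqP/eq_bigl => i; rewrite inE negb_or.
apply: le_trans (weighted_cauchy _ _ q_ge0) _.
rewrite le_eqVlt; apply/orP/or_introl/eqP/eq_bigl => i; rewrite negbK.
have [iuW|] := boolP (v i + u \in W); last by rewrite andbF.
rewrite andbT; apply/esym; apply: contra uW => iW.
by rewrite -(subgrpD u Wg iW) addrC.
Qed.

(** Double counting: a column [i] outside [H] is met by the points [x] of [v i + W], all of which
    lie outside [H]. *)
Lemma sum_cosets W H (F : I -> R) : subgrp H -> W \subset H ->
  \sum_(x | x \notin H) \sum_(i | v i + x \in W) F i
  = #|W|%:R * \sum_(i | v i \notin H) F i.
Proof.
move=> Hg WH; rewrite (exchange_big_dep (fun i => v i \notin H)) /=; last first.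
  move=> x i xH /(subsetP WH) ixH; apply: contra xH => iH.
  by rewrite -(subgrpD x Hg iH) addrC.
rewrite mulr_sumr; apply: eq_bigr => i iH.
rewrite sumr_const mulr_natl -(card_shift W (v i)); congr (_ *+ _).
apply: eq_card => x; rewrite !inE -topredE /=.
have [ixW|] := boolP (v i + x \in W); last by rewrite andbF.
rewrite andbT; apply: contra iH => xH.
by rewrite -(subgrpD (v i) Hg xH) (subsetP WH).
Qed.

(** [cenergy W] is constant on cosets of [W], so the right side is [cweight W x * cenergy W x]. If
    the weight vanishes, so does the mass. *)
Lemma cmass_sqr W x : subgrp W ->
  cmass W x ^+ 2 = \sum_(i | v i + x \in W) q i * cenergy W (v i).
Proof.
move=> Wg; have same i a : v i + x \in W -> (v a + v i \in W) = (v a + x \in W).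
  move=> ixW; rewrite -(subgrpD _ Wg ixW); congr (_ \in W).
  by rewrite addrA addKV.
transitivity (\sum_(i | v i + x \in W) q i * cenergy W x); last first.
  apply: eq_bigr => i ixW; rewrite /cenergy /cmass /cweight.
  by rewrite !(eq_bigl _ _ (fun a => same i a ixW)).
rewrite -mulr_suml -/(cweight W x) /cenergy.
have [C0|C0] := eqVneq (cweight W x) 0; last by field.
rewrite C0 mul0r /cmass big1 ?expr0n // => i ixW.
by have := psumr_eq0P (fun a _ => q_ge0 a) C0 ixW => ->; rewrite mul0r.
Qed.

(** Cauchy-Schwarz for [cmass W] over the [2 ^ j * #|W|] points outside the hyperplane [H]. By
    [sum_cosets] each column is counted [#|W|] times, and [#|W| ^ 2] cancels. *)
Lemma mass_sqr_le j W H : subgrp W -> subgrp H -> W \subset H ->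
    #|V| = (2 * #|H|)%N -> #|H| = (2 ^ j * #|W|)%N ->
  mass H ^+ 2 <= 2 ^+ j * \sum_(i | v i \notin H) q i * cenergy W (v i).
Proof.
move=> Wg Hg WH cV cH.
have W_gt0 : 0 < #|W|%:R :> R.
  by rewrite ltr0n; apply/card_gt0P; exists 0; case: Wg.
have cHC : \sum_(x | x \notin H) (1 : R) = #|H|%:R.
  rewrite sumr_const; congr (_%:R); have := cardC (mem H).
  by rewrite cV mul2n -addnn => /addnI.
have H_gt0 : 0 < #|H|%:R :> R by rewrite cH natrM mulr_gt0 // ltr0n expn_gt0.
have := weighted_cauchy (fun x => x \notin H) (cmass W) (fun=> @ler01 R).
rewrite (eq_bigr (cmass W)) => [|x _]; last by rewrite mul1r.
rewrite [leRHS](eq_bigr (fun x => \sum_(i | v i + x \in W) q i * cenergy W (v i)))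
  => [|x _]; last by rewrite mul1r cmass_sqr.
rewrite !sum_cosets // -/(mass H) cHC ler_pdivrMr //.
rewrite cH natrM natrX; set S := (\sum_(i | _) _).
have -> : #|W|%:R * S * (2 ^+ j * #|W|%:R) = #|W|%:R ^+ 2 * (2 ^+ j * S) by ring.
by rewrite exprMn ler_pM2l // exprn_gt0.
Qed.

Lemma wsum_sqr_coset_le j W :
    subgrp W -> #|V| = (2 ^ j.+1 * #|W|)%N ->
  wsum j W (fun t => mass (spanset W t) ^+ 2) <= 2 ^+ j *
    \sum_(i | v i \notin W) q i * (total j (ext W (v i)) * cenergy W (v i)).
Proof.
move=> Wg cV; apply: (@le_trans _ _ (wsum j W (fun t => 2 ^+ j *
    \sum_(i | v i \notin spanset W t) q i * cenergy W (v i)))).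
  apply: wsum_le => t tj ti; apply: mass_sqr_le => //.
  - exact: subgrp_span.
  - exact: sub_span.
  - by rewrite card_span // tj mulnA -expnS.
  - by rewrite card_span // tj.
rewrite wsumZ (wsum_swap j (fun i _ => cenergy W (v i))) //.
apply: ler_wpM2l; first by rewrite exprn_ge0.
apply: ler_sum => i _; rewrite ler_pM2l // /total mulrC -wsumZ.
by under [leRHS]eq_wsum do rewrite mulr1.
Qed.

Lemma wsum_sqr_le j W : subgrp W -> #|V| = (2 ^ j.+1 * #|W|)%N ->
  wsum j W (fun t => mass (spanset W t) ^+ 2) <=
    2 ^+ j / (2 ^+ j.+1 - 1) * (total j.+1 W * energy W).
Proof.
elim: j W => [|j IH] W Wg cV.
  (* For [j = 0] the constant is 1 and the bound is Cauchy-Schwarz over all columns outside [W]. *)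
  have -> : 2 ^+ 0 / (2 ^+ 1 - 1) = 1 :> R by field.
  rewrite mul1r /total /=; under [X in X * _]eq_bigr do rewrite mulr1.
  have := weighted_cauchy (fun i => v i \notin W) g q_ge0.
  rewrite -/(mass W) -/(energy W); set C := \sum_(i | _) _.
  have [C0 _|C0] := eqVneq C 0; last first.
    by rewrite ler_pdivrMr 1?mulrC // lt_def C0 sumr_ge0.
  rewrite C0 mul0r /mass big1 ?expr0n // => i iW.
  by have := psumr_eq0P (fun a _ => q_ge0 a) C0 iW => ->; rewrite mul0r.
set L := wsum _ _ _; set a := \sum_(i | v i \notin W)
  q i * (total j.+1 (ext W (v i)) * cenergy W (v i)).
have L1 : L <= 2 ^+ j.+1 * a by apply: wsum_sqr_coset_le.
have L2 : L <= 2 ^+ j / (2 ^+ j.+1 - 1) * (total j.+2 W * energy W - a).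
  (* Condition on the first column [i] and apply induction modulo [ext W (v i)]. The energy drops by
     at least [cenergy W (v i)], and these losses add up to [a]. *)
  apply: (@le_trans _ _ (\sum_(i | v i \notin W) q i *
      (2 ^+ j / (2 ^+ j.+1 - 1) *
        (total j.+1 (ext W (v i)) * energy (ext W (v i)))))).
    apply: ler_sum => i iW; rewrite ler_pM2l //; apply: IH.
      exact: subgrp_ext.
    by rewrite card_ext // mulnA -expnSr.
  have -> : total j.+2 W = \sum_(i | v i \notin W)
    q i * total j.+1 (ext W (v i)) by [].
  rewrite mulr_suml -sumrB mulr_sumr; apply: ler_sum => i iW.
  rewrite mulrCA ler_wpM2l //.
    by rewrite divr_ge0 ?exprn_ge0 // subr_ge0 exprn_ege1 // ler1n.
  rewrite -mulrA -mulrBr ler_pM2l // -mulrBr ler_wpM2l ?total_ge0 //.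
  by rewrite lerBrDr energy_ext.
set Y := total _ _ * _ in L2 *.
have : 1 <= 2 ^+ j :> R by rewrite exprn_ege1 // ler1n.
move: L1 L2; rewrite !exprS; set p := 2 ^+ j => L1 L2 p1.
have d1 : 0 < 2 * p - 1 by lra.
have d2 : 0 < 2 * (2 * p) - 1 by lra.
move: L2; rewrite mulrAC ler_pdivlMr // => L2.
(* Dividing each bound by its constant and adding eliminates [a]. *)
by rewrite mulrAC ler_pdivlMr //; nra.
Qed.

(* [cost_nth] is the symmetric form of this recursion. *)
Fixpoint cost W (t : seq I) : R :=
  if t is i :: t' then
    g i * mass (spanset W t') + cost (ext W (v i)) t'
  else 0.

(** Each of the [j.+1] positions contributes equally: drawing the charged column last, its
    [q i * g i] sum to a second factor [mass (spanset W t)]. *)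
Lemma wsum_cost j W : subgrp W ->
  wsum j.+1 W (cost W) = j.+1%:R * wsum j W (fun t => mass (spanset W t) ^+ 2).
Proof.
have step i W' : subgrp W' -> wsum i.+1 W' (cost W') =
    wsum i W' (fun t => mass (spanset W' t) ^+ 2)
    + \sum_(a | v a \notin W') q a * wsum i (ext W' (v a)) (cost (ext W' (v a))).
  move=> Wg /=; under eq_bigr do rewrite wsumD mulrDr.
  rewrite big_split /= -(wsum_swap i (fun a t => g a * mass (spanset W' t))) //.
  congr (_ + _); apply: eq_wsum => t.
  by under eq_bigr do rewrite mulrA; rewrite -mulr_suml expr2.
elim: j W => [|j IH] W Wg.
  by rewrite step //= big1 ?addr0 ?mul1r // => a _; rewrite mulr0.
rewrite step // -[j.+2]addn1 natrD mulrDl mul1r addrC; congr (_ + _).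
rewrite [wsum j.+1 _ _]/= mulr_sumr; apply: eq_bigr => a _.
by rewrite mulrCA -(IH _ (subgrp_ext _ Wg)).
Qed.

Lemma cost_nth i0 W t : cost W t =
  \sum_(p < size t) g (nth i0 t p) *
     mass (spanset W (take p t ++ drop p.+1 t)).
Proof.
elim: t W => [|i t IH] W /=; first by rewrite big_ord0.
by rewrite big_ord_recl /= drop0 IH.
Qed.

Lemma total_gt0 j W :
    (forall W', subgrp W' -> W' != setT -> exists i, v i \notin W') ->
  subgrp W -> #|V| = (2 ^ j * #|W|)%N -> 0 < total j W.
Proof.
move=> spanV; rewrite /total; elim: j W => [|j IH] W Wg cV //=.
have W_gt0 : (0 < #|W|)%N by apply/card_gt0P; exists 0; case: Wg.
have [i iW] : exists i, v i \notin W.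
  apply: spanV => //; apply/eqP => WT; move: cV W_gt0.
  by rewrite WT cardsT expnS; case: #|V| (expn_gt0 2 j) => // m; nia.
rewrite (bigD1 i) //= ltr_pwDl //.
  rewrite mulr_gt0 // IH //; first exact: subgrp_ext.
  by rewrite card_ext // mulnA -expnSr.
by apply: sumr_ge0 => a _; rewrite mulr_ge0 ?total_ge0.
Qed.

Lemma exists_cheap_basis k (eps : R) : (0 < k)%N -> 0 < eps ->
    (forall W', subgrp W' -> W' != setT -> exists i, v i \notin W') ->
    #|V| = (2 ^ k)%N ->
  exists t, [/\ size t = k, indep [set (0 : V)] t &
    cost [set (0 : V)] t <
      k%:R * (2 ^+ k.-1 / (2 ^+ k - 1)) * energy [set (0 : V)] + eps].
Proof.
case: k => // k _ eps_gt0 spanV cV.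
have Wg : subgrp [set (0 : V)].
  by split=> [|x y]; rewrite !inE // => /eqP-> /eqP->; rewrite addr0.
have cV1 : #|V| = (2 ^ k.+1 * #|[set (0%R : V)]|)%N by rewrite cards1 muln1.
set K := k.+1%:R * _ * _.
(* First-moment argument: the mean cost is at most [K], and [eps] makes the weighted sum of
   [K + eps - cost] strictly positive. *)
have [|t [tk ti Kt]] := @wsum_gt0_ex k.+1 [set (0 : V)]
  (fun t => (K + eps) * 1 + -1 * cost [set (0 : V)] t).
  rewrite wsumD !wsumZ mulN1r wsum_cost // subr_gt0 -/(total k.+1 [set (0 : V)]).
  have T0 : 0 < total k.+1 [set (0 : V)] by apply: total_gt0.
  apply: (@le_lt_trans _ _ (K * total k.+1 [set (0 : V)])).
    rewrite /K -!mulrA ler_wpM2l //.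
    by rewrite [energy _ * _]mulrC mulrA wsum_sqr_le.
  by rewrite ltr_pM2r // ltrDl.
by exists t; split=> //; lra.
Qed.

End Sampling.
End Subgroups.

Lemma span_sub (V : finZmodType) (I : finType) (v : I -> V)
    (W K : {set V}) (t : seq I) :
    (forall x : V, x + x = 0) -> subgrp K -> W \subset K ->
  (forall i, i \in t -> v i \in K) -> spanset v W t \subset K.
Proof.
move=> addVV Kg; elim: t W => [|i t IH] W WK tK //=; apply: IH => [|a at_].
  have iK : v i \in K by apply: tK; rewrite mem_head.
  apply/subsetP => x; rewrite inE => /orP[|] /(subsetP WK) //.
  by rewrite subgrpD.
by apply: tK; rewrite inE at_ orbT.
Qed.

(** * Hamming weights of matrices over GF(2) *)

Lemma F2_cases (a : 'F_2) : a = 0 \/ a = 1.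
Proof.
by case: a => [[|[|m]] ?]; [left; exact: val_inj | right; exact: val_inj |].
Qed.

Lemma addF2mx m n (M : 'M['F_2]_(m, n)) : M + M = 0.
Proof.
by apply/matrixP => a b; rewrite !mxE; case: (F2_cases (M a b)) => ->;
  apply: val_inj.
Qed.

Lemma card_F2col r : #|{: 'cV['F_2]_r}| = (2 ^ r)%N.
Proof. by rewrite card_mx card_Fp // muln1. Qed.

Definition colweight m n (M : 'M['F_2]_(m, n)) (j : 'I_n) : nat :=
  (\sum_a (M a j != 0%R))%N.

Lemma sqnormFE m n (M : 'M['F_2]_(m, n)) :
  sqnormF M = (\sum_j colweight M j)%N.
Proof.
rewrite exchange_big pair_big /= /sqnormF -sum1dep_card big_mkcond /=.
by apply: eq_bigr => -[a j] _ /=; case: (F2_cases (M a j)) => ->.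
Qed.

Lemma neq0_sum (I : finType) (x : 'F_2) (c y : I -> 'F_2) :
  (((x - \sum_j y j * c j)%R != 0%R)
    <= (x != 0%R) + \sum_j (c j != 0%R) * (y j != 0%R))%N.
Proof.
have nzD (a b : 'F_2) : (((a + b)%R != 0%R) <= (a != 0%R) + (b != 0%R))%N.
  by case: (F2_cases a) => ->; case: (F2_cases b) => ->.
apply: leq_trans (nzD _ _) _; rewrite leq_add2l oppr_eq0.
apply: (big_ind2 (fun (a : 'F_2) m => ((a != 0%R) <= m)%N)) => //.
  by move=> a m b p am bp; apply: leq_trans (nzD _ _) (leq_add am bp).
by move=> j _; rewrite mulf_eq0 negb_or mulnb andbC.
Qed.

(** Hamming weight is subadditive, and column [j] of [F] is used once for each nonzero entry in row
    [j] of [Q]. *)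
Lemma sqnormF_sub_le d r n (E : 'M['F_2]_(d, n)) (F : 'M_(d, r))
    (Q : 'M_(r, n)) :
  (sqnormF (E - F *m Q)%R <= sqnormF E +
     \sum_j colweight F j * #|[set i | Q j i != 0%R]|)%N.
Proof.
have -> : (\sum_j colweight F j * #|[set i | Q j i != 0%R]| =
    \sum_i \sum_j (Q j i != 0%R) * colweight F j)%N.
  rewrite exchange_big; apply: eq_bigr => j _ /=.
  rewrite -big_distrl mulnC /=; congr (_ * _)%N.
  rewrite -sum1dep_card big_mkcond.
  by apply: eq_bigr => i _; case: (_ != _).
rewrite !sqnormFE -big_split; apply: leq_sum => i _ /=.
have -> : (\sum_j (Q j i != 0%R) * colweight F j =
   \sum_a \sum_j (Q j i != 0%R) * (F a j != 0%R))%N.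
  by rewrite exchange_big; apply: eq_bigr => j _ /=; rewrite -big_distrr.
rewrite -big_split; apply: leq_sum => a _ /=.
by rewrite !mxE; apply: neq0_sum.
Qed.

(** * Column spans and coordinates in a chosen basis *)

Lemma subgrp_ker m r (c : 'M['F_2]_(m, r)) :
  subgrp [set x : 'cV['F_2]_r | c *m x == 0].
Proof.
split=> [|x y]; rewrite !inE ?mulmx0 // => /eqP cx /eqP cy.
by rewrite mulmxDr cx cy addr0.
Qed.

Lemma subgrp_mulmx r n (K : {set 'cV['F_2]_r}) (V : 'M_(r, n)) (y : 'cV_n) :
  subgrp K -> (forall i, col i V \in K) -> V *m y \in K.
Proof.
move=> [K0 KD] VK; have -> : V *m y = \sum_i y i 0 *: col i V.
  apply/colP => a; rewrite !mxE summxE; apply: eq_bigr => i _.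
  by rewrite !mxE mulrC.
apply: (big_ind (fun x => x \in K)) => // i _.
by case: (F2_cases (y i 0)) => ->; rewrite ?scale0r ?scale1r.
Qed.

Lemma subgrp_missing_col r n (V : 'M['F_2]_(r, n)) (W : {set 'cV_r}) :
  row_free V -> subgrp W -> W != setT -> exists i, col i V \notin W.
Proof.
move=> Vfree Wg WT; apply/existsP; apply: contraNT WT => /existsPn colsW.
apply/eqP/setP => x; rewrite inE -[x]mul1mx -(mulmxVp Vfree) -mulmxA.
by apply: subgrp_mulmx => // i; have := colsW i; rewrite negbK.
Qed.

(** A row vector killing the chosen columns kills their span, which has [2 ^ r] points and hence is
    the whole space. *)
Lemma spanning_unit r n (V : 'M['F_2]_(r, n)) (f : 'I_r -> 'I_n)
    (t : seq 'I_n) : t = [seq f p | p <- enum 'I_r] ->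
    indep (fun i => col i V) [set 0] t -> colsub f V \in unitmx.
Proof.
move=> tE ti; have st : size t = r by rewrite tE size_map size_enum_ord.
have Wg : subgrp [set (0 : 'cV['F_2]_r)].
  by split=> [|x y]; rewrite !inE // => /eqP-> /eqP->; rewrite addr0.
rewrite -row_free_unit; apply: inj_row_free => c cV0.
have spT : spanset (fun i => col i V) [set 0] t = setT.
  apply/eqP; rewrite eqEcard subsetT cardsT card_F2col.
  by rewrite (card_span (@addF2mx r 1) Wg ti) cards1 muln1 st leqnn.
have cK (x : 'cV_r) : c *m x = 0.
  apply/eqP; suff: x \in [set x : 'cV['F_2]_r | c *m x == 0] by rewrite inE.
  have /subsetP : spanset (fun i => col i V) [set 0] t
      \subset [set x : 'cV['F_2]_r | c *m x == 0].
    apply: span_sub; [exact: addF2mx|exact: subgrp_ker| |].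
      by apply/subsetP => y; rewrite !inE => /eqP->; rewrite mulmx0.
    move=> i; rewrite tE => /mapP[p _ ->]; rewrite inE.
    have -> : col (f p) V = col p (colsub f V).
      by apply/colP => a; rewrite !mxE.
    by rewrite colE mulmxA cV0 mul0mx.
  by apply; rewrite spT inE.
apply/rowP => j; have /matrixP/(_ 0 0) := cK (delta_mx j 0).
by rewrite -colE !mxE.
Qed.

(** Row [j] of the inverse is a linear form vanishing on every chosen column but the [j]-th, hence
    on the span of the others; its value at column [i] is the coefficient in question. *)
Lemma coef_missed r n (V : 'M['F_2]_(r, n)) (t : seq 'I_n) (i0 : 'I_n)
    (j : 'I_r) (i : 'I_n) :
    let f (p : 'I_r) := nth i0 t p in size t = r ->
    colsub f V \in unitmx -> (invmx (colsub f V) *m V) j i != 0 ->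
  col i V \notin
    spanset (fun i => col i V) [set 0] (take j t ++ drop j.+1 t).
Proof.
move=> f st fV; apply: contra => iH; set B := invmx _.
pose K := [set x : 'cV['F_2]_r | row j B *m x == 0].
have /subsetP/(_ _ iH) : spanset (fun i => col i V) [set 0]
    (take j t ++ drop j.+1 t) \subset K.
  apply: span_sub; [exact: addF2mx|exact: subgrp_ker| |].
    by apply/subsetP => y; rewrite !inE => /eqP->; rewrite mulmx0.
  have fK (p : 'I_r) : p != j -> col (f p) V \in K.
    move=> pj; have -> : col (f p) V = col p (colsub f V).
      by apply/colP => a; rewrite !mxE.
    rewrite inE colE mulmxA -row_mul mulVmx // -row_mul mul1mx.
    by apply/eqP/matrixP => a b; rewrite !mxE eq_sym (negbTE pj).
  move=> a; rewrite mem_cat => /orP[] /(nthP i0) [p].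
    rewrite size_takel ?st ?(ltnW (ltn_ord j)) // => pj <-.
    rewrite nth_take //.
    by apply: (fK (Ordinal (ltn_trans pj (ltn_ord j)))); rewrite neq_ltn /= pj.
  rewrite size_drop st => pj <-; rewrite nth_drop.
  have lt : (j.+1 + p < r)%N by lia.
  apply: (fK (Ordinal lt)); rewrite neq_ltn /=; lia.
rewrite inE colE mulmxA -row_mul -colE => /eqP/matrixP/(_ 0 0).
by rewrite !mxE => ->.
Qed.

(** * From a cheap basis to the approximation bound *)

Lemma column_sampling r d n (A : 'M['F_2]_(d, n)) (U : 'M_(d, r))
    (V : 'M_(r, n)) (i0 : 'I_n) (delta : rat) :
    let K : rat := r%:R * (2 ^+ r.-1 / (2 ^+ r - 1)) in
    row_free V -> (0 < r)%N -> 0 < delta ->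
  exists (f : 'I_r -> 'I_n) (Q : 'M_(r, n)),
    (sqnormF (A - colsub f A *m Q))%:R <=
      (1 + K) * (sqnormF (A - U *m V))%:R + (K * n%:R + 1) * delta.
Proof.
move=> K Vfree r_gt0 delta_gt0; set E := A - U *m V.
(* Adding [delta] keeps [g i] positive even if column [i] of [E] is zero, so that [(g i)^-1] is a
   valid weight. *)
pose g i : rat := (colweight E i)%:R + delta.
have g_gt0 i : 0 < g i by rewrite ltr_wpDl.
have q_gt0 i : 0 < (g i)^-1 by rewrite invr_gt0.
have [t [st ti]] := exists_cheap_basis (@addF2mx r 1) g q_gt0 r_gt0 delta_gt0
  (fun W => @subgrp_missing_col r n V W Vfree) (card_F2col r).
pose f (p : 'I_r) := nth i0 t p.
have tE : t = [seq f p | p <- enum 'I_r].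
  by rewrite /f (map_comp (nth i0 t) val) val_enum_ord -st -/(mkseq _ _) mkseq_nth.
have Vu := spanning_unit tE ti.
have energy_le :
    energy (fun i => col i V) (fun i => (g i)^-1) g [set (0 : 'cV['F_2]_r)]
      <= (sqnormF E)%:R + n%:R * delta.
  apply: (@le_trans _ _ (\sum_i g i)).
    rewrite /energy big_mkcond; apply: ler_sum => i _; case: ifP => // _.
      by rewrite expr2 mulrA mulVf ?mul1r // gt_eqF.
    exact: ltW.
  by rewrite sqnormFE natr_sum big_split sumr_const card_ord mulr_natl.
have K_ge0 : 0 <= K.
  by rewrite mulr_ge0 // divr_ge0 ?exprn_ge0 // subr_ge0 exprn_ege1.
set Q := invmx (colsub f V) *m V; move=> cost_lt; exists f, Q.
(* [Q] expresses the columns of [V] in the chosen basis, so [colsub f V *m Q = V] and the [U *m V]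
   parts cancel. *)
have -> : A - colsub f A *m Q = E - colsub f E *m Q.
  have -> : colsub f E = colsub f A - U *m colsub f V.
    by rewrite mulmx_colsub; apply/matrixP => a b; rewrite !mxE.
  rewrite mulmxBl /Q -[U *m _ *m _]mulmxA mulKVmx // /E.
  by rewrite opprB addrA subrK.
apply: (@le_trans _ _ ((sqnormF E)%:R +
    cost (fun i => col i V) (fun i => (g i)^-1) g [set (0 : 'cV['F_2]_r)] t)).
  apply: le_trans (_ : _ <= (sqnormF E +
    \sum_j colweight (colsub f E) j * #|[set i | Q j i != 0%R]|)%N%:R) _.
    by rewrite ler_nat sqnormF_sub_le.
  rewrite natrD lerD2l natr_sum (cost_nth _ _ _ i0) st; apply: ler_sum => j _.
  rewrite natrM; apply: ler_pM => //.
    have -> : colweight (colsub f E) j = colweight E (f j).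
      by apply: eq_bigr => a _; rewrite mxE.
    by rewrite lerDl ltW.
  rewrite /mass; under [leRHS]eq_bigr do rewrite mulVf ?gt_eqF //.
  rewrite sumr_const ler_nat; apply/subset_leq_card/subsetP => i.
  by rewrite !inE => Qji; apply: (coef_missed st Vu Qji).
have : K * energy (fun i => col i V) (fun i => (g i)^-1) g
    [set (0 : 'cV['F_2]_r)] <= K * ((sqnormF E)%:R + n%:R * delta).
  by rewrite ler_wpM2l.
by move: cost_lt; rewrite -/K; nra.
Qed.

(** The missing columns are copies of column [i0], multiplied by zero rows. *)
Lemma pad_columns r k d n (A : 'M['F_2]_(d, n)) (f : 'I_r -> 'I_n)
    (Q : 'M_(r, n)) (i0 : 'I_n) : (r <= k)%N ->
  exists (PA : 'M_(d, k)) (Q' : 'M_(k, n)),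
    (forall j, exists i, col j PA = col i A) /\ PA *m Q' = colsub f A *m Q.
Proof.
move=> /subnKC <-; set s := (k - r)%N.
exists (row_mx (colsub f A) (colsub (fun=> i0) A)), (col_mx Q (0 : 'M_(s, n))).
split; last by rewrite mul_row_col mulmx0 addr0.
move=> j; exists (if split j is inl p then f p else i0).
by apply/colP => a; rewrite !mxE; case: (split j) => p; rewrite mxE.
Qed.

(** Sampling takes place at the rank of [V], which may be below [k], so the factor must be monotone.
    In the step from [m.+1] to [m.+2], clearing denominators leaves [x <= 4 * p - 2]. *)
Lemma factor_homo (r k : nat) : (r <= k)%N ->
  r%:R * (2 ^+ r.-1 / (2 ^+ r - 1)) <= k%:R * (2 ^+ k.-1 / (2 ^+ k - 1)) :> rat.
Proof.
apply: (@homo_leq _ (fun m => m%:R * (2 ^+ m.-1 / (2 ^+ m - 1)) : rat)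
  (fun a b => a <= b)) => [//|x y z|[|m]].
- exact: le_trans.
- by rewrite mul0r mulr_ge0 // divr_ge0 ?exprn_ge0 // subr_ge0 exprn_ege1.
rewrite /= !exprS; set p := 2 ^+ m; set x := m.+1%:R.
have px : x <= p by rewrite /x /p -natrX ler_nat ltn_expl.
have x1 : 1 <= x by rewrite ler1n.
rewrite -[m.+2%:R]/((m.+1).+1%:R) -[(m.+1).+1]addn1 natrD -/x !mulrA.
rewrite ler_pdivrMr; last by lra.
rewrite mulrAC ler_pdivlMr; last by lra.
by nra.
Qed.

Lemma factorE k : (0 < k)%N -> k%:R / 2 + 1 + k%:R / (2 * (2 ^+ k - 1))
  = 1 + k%:R * (2 ^+ k.-1 / (2 ^+ k - 1)) :> rat.
Proof.
case: k => // k _; rewrite exprS /=; set p := 2 ^+ k.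
have : 1 <= p by rewrite exprn_ege1.
by move=> p1; field; lra.
Qed.

Theorem theorem1 (k d n : nat) (k_ge1 : (1 <= k)%N) (n_ge1 : (1 <= n)%N)
    (A : 'M['F_2]_(d, n)) :
  exists (PA : 'M['F_2]_(d, k)) (Q : 'M['F_2]_(k, n)),
    (forall j : 'I_k, exists i : 'I_n, col j PA = col i A) /\
    (sqnormF (A - PA *m Q))%:R
      <= (k%:R / 2 + 1 + k%:R / (2 * (2 ^+ k - 1))) * (OPT k A)%:R :> rat.
Proof.
rewrite factorE //; set C : rat := _ + _; pose i0 := Ordinal n_ge1.
pose good (PQ : 'M['F_2]_(d, k) * 'M['F_2]_(k, n)) :=
  [forall j, exists i, col j PQ.1 == col i A].
have goodP PQ : reflect (forall j, exists i, col j PQ.1 = col i A) (good PQ).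
  apply: (iffP forallP) => [h j|h j].
    by have /existsP[i /eqP] := h j; exists i.
  by apply/existsP; have [i ->] := h j; exists i.
have approx (eps : rat) : 0 < eps -> exists PQ, good PQ /\
    (factor_err A PQ)%:R <= C * (OPT k A)%:R + eps.
  move=> eps_gt0; have [U [V ->]] := OPT_attained k A.
  set r := \rank V; set K : rat := r%:R * (2 ^+ r.-1 / (2 ^+ r - 1)).
  have rk : (r <= k)%N by apply: rank_leq_row.
  have KC : 1 + K <= C by rewrite lerD2l factor_homo.
  have K_ge0 : 0 <= K.
    by rewrite mulr_ge0 // divr_ge0 ?exprn_ge0 // subr_ge0 exprn_ege1.
  suff [f [Q fQ]] : exists (f : 'I_r -> 'I_n) (Q : 'M_(r, n)),
      (sqnormF (A - colsub f A *m Q))%:R <=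
        (1 + K) * (sqnormF (A - U *m V))%:R + eps.
    have [PA [Q' [PAcol PAQ]]] := pad_columns A f Q i0 rk.
    exists (PA, Q'); split; first exact/goodP.
    rewrite /factor_err /= PAQ; apply: le_trans fQ _.
    by rewrite lerD2r ler_wpM2r.
  (* Moving the column base of [V] into [U] leaves a right factor of full row rank [r]. *)
  rewrite -[V]mulmx_base mulmxA; have Vfree := row_base_free V.
  move: (U *m _) (row_base V) Vfree => U' V' Vfree.
  have [r0|r_gt0] := posnP r.
    exists (fun=> i0), 0; rewrite mulmx0.
    have -> : U' *m V' = 0.
      apply/matrixP => a b; rewrite !mxE big1 // => p _.
      by have := ltn_ord p; rewrite [X in (_ < X)%N]r0.
    rewrite subr0 mulrDl mul1r -addrA lerDl.
    by apply: addr_ge0; [apply: mulr_ge0 | apply: ltW].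
  have Kn_gt0 : 0 < K * n%:R + 1 by rewrite ltr_wpDl // mulr_ge0.
  have [|f [Q fQ]] := @column_sampling r d n A U' V' i0
    (eps / (K * n%:R + 1)) Vfree r_gt0; first by rewrite divr_gt0.
  by exists f, Q; rewrite [_ * (eps / _)]mulrC divfK ?gt_eqF // in fQ.
(* One minimizer over the finitely many admissible pairs serves every [eps], so [eps] can tend to
   0. *)
have [PQ0 [good0 _]] := approx 1 ltr01.
case: (arg_minnP (factor_err A) good0) => -[PA Q] /goodP PAcol PAmin.
exists PA, Q; split=> //; apply/ler_addgt0Pr => eps /approx[PQ [PQgood PQle]].
by apply: le_trans PQle; rewrite ler_nat; apply: PAmin.
Qed.
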